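(* For every integer $n\ge 0$, Motzkin paths of length $n$ are in one-to-one correspondence with the permutations in $\mathcal{S}_n$ that avoid both $(a\text{-}bc)$ and $(ac\text{-}b)$. Hence $$|\mathcal{S}_n(a\text{-}bc,\,ac\text{-}b)|=M_n,$$ where $M_n$ is the $n$th Motzkin number, i.e. the number of Motzkin paths of length $n$.
   Context: $\mathcal{S}_n$ is the set of permutations of $[n]=\{1,2,\ldots,n\}$, written as words $\pi=a_1a_2\cdots a_n$ (with $\mathcal{S}_0$ consisting of the empty word only). A (generalised) pattern is a word in distinct letters of the ordered alphabet $a<b<c<\cdots$ in which two adjacent letters may or may not be separated by a dash. A $p$-subword of $\pi$ is a subword $a_{i_1}a_{i_2}\cdots a_{i_k}$ ($i_1<i_2<\cdots<i_k$) whose letters are in the same relative order as the letters of $p$, and such that $i_{j+1}=i_j+1$ whenever the $j$th and $(j+1)$st letters of $p$ are not separated by a dash. So an $(a\text{-}bc)$-subword is a subword $a_ia_ja_{j+1}$ with $i<j$ and $a_i<a_j<a_{j+1}$, and an $(ac\text{-}b)$-subword is a subword $a_ia_{i+1}a_j$ with $i+1<j$ and $a_i<a_j<a_{i+1}$. A permutation avoids $p$ if it has no $p$-subword; $\mathcal{S}_n(p,q)$ is the set of permutations in $\mathcal{S}_n$ avoiding both $p$ and $q$. A Motzkin path of length $n$ is a lattice path from $(0,0)$ to $(n,0)$ with steps $(1,0)$, $(1,1)$ and $(1,-1)$ that never goes below the $x$-axis. *)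

(* Defs.v *)
From HB Require Import structures.
From mathcomp Require Import all_boot all_order all_algebra all_fingroup.
Set Implicit Arguments.
Unset Strict Implicit.
Unset Printing Implicit Defensive.
Import GRing.Theory Num.Theory.

(* The letters a < b < c < ... are encoded as 0 < 1 < 2 < ...; the j-th entry
   of [gp_dash] tells whether the letters at positions j and j.+1 (counted
   from 0) are separated by a dash. *)
Record gpattern := GPattern {
  gp_word : seq nat;
  gp_dash : seq bool;
  gp_wf : uniq gp_word && (size gp_dash == (size gp_word).-1)
}.

Definition pat_a_bc : gpattern := @GPattern [:: 0; 1; 2] [:: true; false] isT.
Definition pat_ac_b : gpattern := @GPattern [:: 0; 2; 1] [:: false; true] isT.

(* A permutation of {1, ..., n} is an element of 'S_n, both positions and
   values being shifted down by one: the word a_1 ... a_n is s 0 ... s (n-1).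
   A subword is given by the family i of the positions of its letters. *)
Definition is_psubword (p : gpattern) (n : nat) (s : 'S_n)
    (i : {ffun 'I_(size (gp_word p)) -> 'I_n}) : bool :=
  let I := 'I_(size (gp_word p)) in
  [&& [forall j : I, forall k : I, (j < k) ==> (i j < i k)],
      [forall j : I, forall k : I,
         (s (i j) < s (i k)) == (nth 0 (gp_word p) j < nth 0 (gp_word p) k)]
    & [forall j : I, forall k : I,
         (k == j.+1 :> nat) && ~~ nth true (gp_dash p) j
           ==> (i k == (i j).+1 :> nat)]].

Definition avoids (p : gpattern) (n : nat) (s : 'S_n) : bool :=
  ~~ [exists i : {ffun 'I_(size (gp_word p)) -> 'I_n}, is_psubword s i].

Definition avoiders (n : nat) (p q : gpattern) : {set 'S_n} :=
  [set s : 'S_n | avoids p s && avoids q s].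

Inductive motzkin_step := Level | Up | Down.

Definition step_code (s : motzkin_step) : option bool :=
  match s with Level => None | Up => Some true | Down => Some false end.

Definition step_decode (c : option bool) : motzkin_step :=
  match c with None => Level | Some true => Up | Some false => Down end.

Lemma step_codeK : cancel step_code step_decode.
Proof. by case. Qed.

HB.instance Definition _ := Finite.copy motzkin_step (can_type step_codeK).

Definition step_vec (s : motzkin_step) : int * int :=
  match s with
  | Level => (1, 0)%R
  | Up => (1, 1)%R
  | Down => (1, -1)%R
  end.

Definition path_end (w : seq motzkin_step) : int * int :=
  (\sum_(s <- w) step_vec s)%R.

(* Every step moves one unit to the right, so a path from (0,0) to (n,0) has
   exactly n steps. *)
Definition motzkin_paths (n : nat) : {set n.-tuple motzkin_step} :=
  [set w : n.-tuple motzkin_step |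
    (path_end w == (Posz n, 0%R)) &&
    [forall k : 'I_n.+1, (0 <= (path_end (take k w)).2)%R]].

Definition motzkin_number (n : nat) : nat := #|motzkin_paths n|.

(* Main.v *)
Require Import Defs.
From mathcomp Require Import all_boot all_order all_algebra all_fingroup.
From mathcomp Require Import zify.
Set Implicit Arguments.
Unset Strict Implicit.
Unset Printing Implicit Defensive.

(** Both families are obtained by unfolding the same trees.

    A nonempty Motzkin path either starts with a level step followed by a
    Motzkin path, or is uniquely U p D q with p and q Motzkin paths (cut at the
    first return to the axis).

    Avoiding a-bc and ac-b means that around each ascent b < c at adjacent
    places, all earlier letters exceed b and no later letter lies strictly
    between b and c ([admissible]).  Look at the largest letter M of such a
    word.  If M comes first, it is in no subword forming either pattern and the
    rest is an arbitrary admissible word.  Otherwise M is preceded by some x,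
    and the ascent x M forces the word to be p x M q with every letter of p
    above x and every letter of q below x ([perm_peak]); conversely any
    admissible p and q with these ranges give an admissible word, since every
    ascent other than x M lies within p or within q ([admissible_arch]).  So x
    is determined by the length of q, and p, q are again of the same kind up to
    a shift of their values.

    Thus both decompositions are those of a tree that is empty, a root with one
    subtree, or a root with two subtrees, where the two kinds of root account
    for one and two letters respectively.  Reading a tree as a path ([steps])
    and as a word ([letters]) are two bijections that preserve the size; the
    correspondence of the theorem relates the two readings of one tree. *)

(** * Trees and their reading as paths *)

Inductive mtree := Leaf | Flat of mtree | Arch of mtree & mtree.

Fixpoint weight t :=
  match t with
  | Leaf => 0
  | Flat t1 => (weight t1).+1
  | Arch t1 t2 => (weight t1 + weight t2).+2
  end.

Fixpoint steps t : seq motzkin_step :=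
  match t with
  | Leaf => [::]
  | Flat t1 => Level :: steps t1
  | Arch t1 t2 => Up :: steps t1 ++ Down :: steps t2
  end.

Lemma size_steps t : size (steps t) = weight t.
Proof.
by elim: t => //= [t -> //|t1 IH1 t2 IH2]; rewrite size_cat /= IH1 IH2 addnS.
Qed.

(** Starting at height [h], the path stays nonnegative and ends at height 0.
    Letting the starting height vary makes this condition recursive in the
    first step. *)
Fixpoint closes h (w : seq motzkin_step) :=
  match w, h with
  | [::], _ => h == 0
  | Level :: w', _ => closes h w'
  | Up :: w', _ => closes h.+1 w'
  | Down :: w', 0 => false
  | Down :: w', h'.+1 => closes h' w'
  end.

Lemma path_end_cons s w : path_end (s :: w) = (step_vec s + path_end w)%R.
Proof. by rewrite /path_end big_cons. Qed.

Lemma path_end_width w : (path_end w).1 = Posz (size w).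
Proof.
elim: w => [|s w IH]; first by rewrite /path_end big_nil.
by rewrite path_end_cons /= IH; case: s => /=; lia.
Qed.

Lemma closesP h w :
  closes h w <->
  (Posz h + (path_end w).2 = 0)%R /\
  forall k, k <= size w -> (0 <= Posz h + (path_end (take k w)).2)%R.
Proof.
elim: w h => [|s w IH] h /=.
  rewrite /path_end big_nil /=; split=> [/eqP-> //|[]]; lia.
have closes_step h' : (Posz h' = Posz h + (step_vec s).2)%R ->
  closes h' w <->
  (Posz h + (path_end (s :: w)).2 = 0)%R /\
  (forall k, k <= (size w).+1 ->
     (0 <= Posz h + (path_end (take k (s :: w))).2)%R).
  move=> def_h'; rewrite IH path_end_cons /= def_h' -GRing.addrA.
  split=> [[end0 ge0]|[end0 ge0]]; split=> // k lekw.
    case: k lekw => [|k] lekw; first by rewrite take0 /path_end big_nil /=; lia.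
    by rewrite /= path_end_cons /= GRing.addrA -def_h' def_h'; apply: ge0.
  by have:= ge0 k.+1 lekw; rewrite /= path_end_cons /= GRing.addrA.
case: s closes_step => step; try by apply: step => /=; lia.
case: h step => [|h] step; last by apply: step => /=; lia.
(* A down step from height 0 already violates nonnegativity at k = 1. *)
split=> // -[_ /(_ 1 isT)].
by rewrite /= take0 path_end_cons /path_end big_nil /=; lia.
Qed.

Lemma mem_motzkin_paths n (w : n.-tuple motzkin_step) :
  (w \in motzkin_paths n) = closes 0 w.
Proof.
rewrite inE; apply/andP/idP => [[/eqP endw /forallP ge0]|/closesP[endw ge0]].
  apply/closesP; rewrite endw; split=> // k; rewrite size_tuple -ltnS => ltkn.
  by have:= ge0 (Ordinal ltkn); rewrite GRing.add0r.
split; last first.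
  apply/forallP=> k; have:= ge0 k; rewrite GRing.add0r; apply.
  by rewrite size_tuple -ltnS.
rewrite [path_end w]surjective_pairing path_end_width size_tuple.
by move: endw; rewrite GRing.add0r => ->.
Qed.

Lemma closes_steps_cat t h w : closes h (steps t ++ w) = closes h w.
Proof.
elim: t h w => //= t1 IH1 t2 IH2 h w.
by rewrite -catA IH1 /= IH2.
Qed.

(** What can follow the code of a subtree in the code of a tree: only the end of
    the path or the down step closing the enclosing arch. *)
Definition stuck (w : seq motzkin_step) :=
  if w is s :: _ then s == Down else true.

(** The code of a tree followed by a stuck word can be read off greedily, since
    that word cannot begin with a step that would prolong the tree. *)
Lemma steps_cat_inj t t' w w' : stuck w -> stuck w' ->
  steps t ++ w = steps t' ++ w' -> t = t' /\ w = w'.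
Proof.
elim: t t' w w' => [|t IH|t1 IH1 t2 IH2] [|t'|t1' t2'] w w' sw sw' //=.
- by move=> def_w; rewrite def_w in sw.
- by move=> def_w; rewrite def_w in sw.
- by move=> def_w; rewrite -def_w in sw'.
- by case=> /IH[] // -> ->.
- by move=> def_w; rewrite -def_w in sw'.
case; rewrite -!catA /= => /IH1[] // -> [].
by case/IH2=> // -> ->.
Qed.

(** Greedy parsing: after an up step, parsing cannot run to the end of the path,
    as the height would stay positive; so it stops at the down step that closes
    the arch, and resumes behind it. *)
Lemma parse_steps h w : closes h w ->
  exists t w', [/\ w = steps t ++ w', closes h w' & stuck w'].
Proof.
have [N] := ubnP (size w); elim: N w h => // N IH [|[] w] h /= ltwN.
- by exists Leaf, [::].
- by case/IH=> // t [w' [-> ? ?]]; exists (Flat t), w'.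
- case/IH=> // t1 [[|s w1] [def_w]] //= cl1 /eqP def_s.
  subst; rewrite size_cat /= in ltwN.
  case/IH: cl1 => [|t2 [w2 [-> ? ?]]]; first by lia.
  by exists (Arch t1 t2), w2; rewrite /= -catA.
by move=> clw; exists Leaf, (Down :: w).
Qed.

Lemma closes_steps w : closes 0 w -> exists t, w = steps t.
Proof.
by case/parse_steps=> t [[|[] w'] [->]] //; exists t; rewrite cats0.
Qed.

Lemma steps_inj : injective steps.
Proof.
move=> t t' eq_tt'.
by have [|||->] := @steps_cat_inj t t' [::] [::]; rewrite ?cats0.
Qed.

(** * Trees read as words *)

(** The base [m] is the smallest value used: in an arch the right subtree takes
    the values from [m] on, then comes the letter preceding the maximum, and
    the left subtree takes the values between that letter and the maximum. *)
Fixpoint letters m t : seq nat :=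
  match t with
  | Leaf => [::]
  | Flat t1 => m + weight t1 :: letters m t1
  | Arch t1 t2 =>
      letters (m + weight t2).+1 t1
        ++ [:: m + weight t2, (m + weight t2 + weight t1).+1 & letters m t2]
  end.

Lemma size_letters m t : size (letters m t) = weight t.
Proof.
elim: t m => //= [t IH m|t1 IH1 t2 IH2 m]; first by rewrite IH.
by rewrite size_cat /= IH1 IH2 !addnS.
Qed.
Lemma mem_letters m t x : (x \in letters m t) = (m <= x < m + weight t).
Proof.
elim: t m => /= [m|t IH m|t1 IH1 t2 IH2 m]; first by rewrite in_nil; lia.
  by rewrite inE IH; lia.
by rewrite mem_cat !inE IH1 IH2; lia.
Qed.

Lemma uniq_letters m t : uniq (letters m t).
Proof.
elim: t m => //= [t IH m|t1 IH1 t2 IH2 m].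
  by rewrite IH mem_letters ltnn andbF.
rewrite cat_uniq /= IH1 IH2 !inE !mem_letters !negb_or !andbT /=.
have -> : has (mem (letters (m + weight t2).+1 t1)) (letters m t2) = false.
  by apply/hasP=> -[x]; rewrite /= !mem_letters; lia.
by rewrite andbT; lia.
Qed.

Lemma perm_letters m t : perm_eq (letters m t) (iota m (weight t)).
Proof.
by apply: uniq_perm; rewrite ?uniq_letters ?iota_uniq // => x;
  rewrite mem_letters mem_iota.
Qed.

(** The place of the largest letter tells a flat root, for which it comes first,
    from an arch, and reveals the size of the left subtree of the arch. *)
Lemma index_max_Arch m t1 t2 :
  index (m + weight t2 + weight t1).+1 (letters m (Arch t1 t2))
    = (weight t1).+1.
Proof.
rewrite /= index_cat mem_letters ifN; last by lia.
rewrite /= eqxx ifN; last by apply/eqP; lia.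
by rewrite size_letters addn1.
Qed.

Lemma letters_inj m : injective (letters m).
Proof.
move=> t; elim: t m => [|t IH|t1 IH1 t2 IH2] m t' eqw;
  have:= congr1 size eqw; rewrite !size_letters.
- by case: t' {eqw}.
- case: t' eqw => [|t'|t1' t2'] //= eqw [eqW]; first by case: eqw => _ /IH->.
  have:= index_max_Arch m t1' t2'; rewrite /= -eqw /= eqW ifT //.
  by apply/eqP; lia.
case: t' eqw => [|t'|t1' t2'] //= eqw [eqW].
  have:= index_max_Arch m t1 t2; rewrite /= eqw /= -eqW ifT //.
  by apply/eqP; lia.
have eqW1: weight t1 = weight t1'.
  have:= index_max_Arch m t1' t2'; rewrite /= -eqw.
  have -> : m + weight t2' + weight t1' = m + weight t2 + weight t1 by lia.
  by have:= index_max_Arch m t1 t2 => /= -> [].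
have eqW2: weight t2 = weight t2' by lia.
move/eqP: eqw; rewrite eqseq_cat ?size_letters // eqW1 eqW2 => /andP[].
by move=> /eqP/IH1 -> /eqP[] /IH2 ->.
Qed.

(** * Admissible words *)

(** The avoidance of both patterns, gathered around each ascent: a letter before
    [b, c] smaller than [b] would play a in a-bc, a letter after it strictly
    between the two would play b in ac-b.  Weak inequalities suffice as letters
    of a permutation are distinct. *)
Definition admissible (w : seq nat) :=
  forall u b c v, w = u ++ [:: b, c & v] -> b < c ->
  all (leq b) u /\ all (fun x => (x <= b) || (c <= x)) v.

Lemma admissible_factor p w q : admissible (p ++ w ++ q) -> admissible w.
Proof.
move=> adm u b c v def_w ltbc.
have [] := adm (p ++ u) b c (v ++ q) _ ltbc; first by rewrite def_w -!catA.
by rewrite !all_cat => /andP[_ ->] /andP[-> _].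
Qed.

(** Locates a cut of a word relative to a given concatenation; used to find
    where an ascent of a concatenation falls. *)
Lemma cat_eq_cat (T : Type) (u v p q : seq T) : u ++ v = p ++ q ->
  (exists k, p = u ++ k /\ v = k ++ q) \/ (exists k, u = p ++ k /\ q = k ++ v).
Proof.
elim: u p => [|x u IH] [|y p] /=.
- by move=> ->; left; exists [::].
- by move=> ->; left; exists (y :: p).
- by move=> <-; right; exists (x :: u).
case=> -> /IH[[k [-> ->]]|[k [-> ->]]]; [left | right]; by exists k.
Qed.

Lemma admissible_max_cons M w : all (fun y => y < M) w ->
  admissible w -> admissible (M :: w).
Proof.
move=> /allP ltwM adm [|a u] b c v [].
  move=> <- def_w ltMc; have:= ltwM c; rewrite def_w inE eqxx /=.
  by move/(_ isT)/ltnW; rewrite leqNgt ltMc.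
move=> <- def_w ltbc; have [ub vbc] := adm _ _ _ _ def_w ltbc.
split=> //=; rewrite ub andbT ltnW //; apply: ltwM.
by rewrite def_w mem_cat inE eqxx orbT.
Qed.

(** Joining [p] to [x] and [M] to [q] creates descents only, so an ascent is
    [x, M] or lies within [p] or within [q]; its conditions on the remaining
    letters follow from [q] < [x] < [p] < [M]. *)
Lemma admissible_arch p x M q :
  all (fun y => x < y < M) p -> all (fun y => y < x) q -> x < M ->
  admissible p -> admissible q -> admissible (p ++ [:: x, M & q]).
Proof.
move=> /allP ltxpM /allP ltqx ltxM admp admq u b c v.
have peak_ok : all (leq x) p /\ all (fun y => (y <= x) || (M <= y)) q.
  split; apply/allP=> y; first by move/ltxpM/andP=> [/ltnW].
  by move/ltqx/ltnW=> ->.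
(* The three cases k = [::], [:: d], [:: d, e & k] say that the ascent b c is
   x M itself, straddles the junction (impossible), or lies within p (first
   alternative) or within q (second alternative). *)
move/esym/cat_eq_cat=> [[[|d [|e k]] [def_p []]]|[[|d [|e k]] [def_u []]]] /=.
- by move=> -> -> ->; rewrite cats0 in def_p; subst u.
- move=> eq_b -> _; subst d.
  have /ltxpM : b \in p by rewrite def_p mem_cat inE eqxx orbT.
  by lia.
- move=> eq_b eq_c -> ltbc; subst d e.
  have [-> vok] := admp _ _ _ _ def_p ltbc; split=> //.
  have /ltxpM bnd_b : b \in p by rewrite def_p mem_cat !inE eqxx !orbT.
  have /ltxpM bnd_c : c \in p by rewrite def_p mem_cat !inE eqxx !orbT.
  rewrite all_cat vok /=; apply/and3P; split; try lia.
  by apply/allP=> y /ltqx; lia.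
- by move=> <- <- <-; rewrite def_u cats0.
- move=> _ <- def_q; have /ltqx : c \in q by rewrite def_q inE eqxx.
  by lia.
move=> eq_x eq_M def_q ltbc; subst d e.
have [kok ->] := admq _ _ _ _ def_q ltbc; split=> //.
have /ltqx bnd_b : b \in q by rewrite def_q mem_cat !inE eqxx !orbT.
rewrite def_u all_cat /= kok; apply/and4P; split; try lia.
by apply/allP=> y /ltxpM; lia.
Qed.

Lemma admissible_letters m t : admissible (letters m t).
Proof.
elim: t m => [|t IH|t1 IH1 t2 IH2] m /=; first by case.
  by apply: admissible_max_cons => //; apply/allP=> x; rewrite mem_letters; lia.
apply: admissible_arch; rewrite ?IH1 //; try lia.
  by apply/allP=> x; rewrite mem_letters; lia.
by apply/allP=> x; rewrite mem_letters; lia.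
Qed.

(** The ascent ending at the maximum separates the values: no later letter fits
    between [x] and the maximum, and no earlier one is below [x]. *)
Lemma perm_peak m n u x v :
  perm_eq (u ++ [:: x, m + n & v]) (iota m n.+1) ->
  admissible (u ++ [:: x, m + n & v]) ->
  [/\ m <= x < m + n, perm_eq u (iota x.+1 (m + n - x.+1))
    & perm_eq v (iota m (x - m))].
Proof.
move=> perm_w adm.
have : uniq (u ++ [:: x, m + n & v]) by rewrite (perm_uniq perm_w) iota_uniq.
have mem_w y : [|| y \in u, y == x, y == m + n | y \in v]
                 = (m <= y < m + n.+1).
  by rewrite -mem_iota -(perm_mem perm_w) mem_cat !inE.
rewrite cat_uniq !cons_uniq inE /= !negb_or -!andbA.
case/and5P=> uniq_u x'u M'u v'u /and4P[neMx v'x M'v uniq_v].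
have {}v'u y : (y \in u) && (y \in v) = false.
  by apply: contraNF v'u => /andP[yu yv]; apply/hasP; exists y.
have bnd_x : m <= x < m + n.
  by have := mem_w x; rewrite eqxx orbT; clear -neMx; lia.
have /andP[lemx ltxM] := bnd_x.
have [/allP leu /allP lev] := adm _ _ _ _ erefl ltxM.
have mem_uv y : (y \in u) = (x < y < m + n) /\ (y \in v) = (m <= y < x).
  have [->|neyx] := eqVneq y x.
    by rewrite (negPf x'u) (negPf v'x); clear; lia.
  have [->|neyM] := eqVneq y (m + n).
    by rewrite (negPf M'u) (negPf M'v); clear -ltxM; lia.
  move: (mem_w y) (leu y) (lev y) (v'u y); rewrite (negPf neyx) (negPf neyM) /=.
  case: (y \in u) => [/= bnd_y /(_ isT) lexy _ /= -> | /= -> _ bnd_y _].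
    by clear -neyx neyM bnd_y lexy lemx; lia.
  by clear -neyx neyM bnd_y lemx ltxM; lia.
by split=> //; apply: uniq_perm; rewrite ?iota_uniq // => y;
  have [yu yv] := mem_uv y; rewrite mem_iota ?yu ?yv; clear -lemx ltxM; lia.
Qed.

(** Cut at the maximum, by induction on the length; the base varies because the
    left part of an arch uses values starting above [x]. *)
Lemma admissible_lettersP m n w : perm_eq w (iota m n) -> admissible w ->
  exists t, w = letters m t.
Proof.
have [N] := ubnP n; elim: N m n w => // N IH m [|n] w ltnN perm_w adm.
  by exists Leaf; apply/perm_nilP.
have Mw : m + n \in w by rewrite (perm_mem perm_w) mem_iota; clear; lia.
have weight_size k l t : perm_eq (letters k t) (iota k l) -> weight t = l.
  by move/perm_size; rewrite size_letters size_iota.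
case/splitPr: Mw => u v in perm_w adm *.
case/lastP: u => [|u x] in perm_w adm *.
  have perm_v : perm_eq v (iota m n).
    rewrite -(perm_cons (m + n)) (permPl perm_w) -[n.+1]addn1 iotaD perm_catC.
    exact: perm_refl.
  have [//||t def_v] := IH m n v _ perm_v.
    by apply: (@admissible_factor [:: m + n] v [::]); rewrite cats0.
  by exists (Flat t); rewrite /= -def_v (weight_size m n) // -def_v.
rewrite cat_rcons in perm_w adm *.
have [/andP[lemx ltxM] perm_u perm_v] := perm_peak perm_w adm.
have [|| t1 def_u] := IH _ _ _ _ perm_u; first by clear -lemx ltnN; lia.
  exact: (@admissible_factor [::] u [:: x, m + n & v]).
have [|| t2 def_v] := IH _ _ _ _ perm_v; first by clear -ltxM ltnN; lia.
  apply: (@admissible_factor (u ++ [:: x; m + n]) v [::]).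
  by rewrite cats0 -catA.
exists (Arch t1 t2) => /=.
rewrite (weight_size x.+1 (m + n - x.+1) t1) -?def_u //.
rewrite (weight_size m (x - m) t2) -?def_v // subnKC // -def_u -addSn subnKC //.
Qed.

(** * Permutations and pattern avoidance *)
Definition word_of n (s : 'S_n) : seq nat := [seq val (s i) | i <- enum 'I_n].

Lemma size_word_of n (s : 'S_n) : size (word_of s) = n.
Proof. by rewrite size_map size_enum_ord. Qed.

Lemma nth_word_of n (s : 'S_n) (i : 'I_n) : nth 0 (word_of s) i = s i.
Proof. by rewrite (nth_map i) ?size_enum_ord // nth_ord_enum. Qed.

Lemma word_of_inj n : injective (@word_of n).
Proof.
move=> s s' eqw; apply/permP=> i; apply: val_inj.
by rewrite /= -!nth_word_of eqw.
Qed.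

Lemma perm_word_of n (s : 'S_n) : perm_eq (word_of s) (iota 0 n).
Proof.
have uniq_w : uniq (word_of s).
  by rewrite map_inj_uniq ?enum_uniq // => i j /val_inj/perm_inj.
apply: uniq_perm; rewrite ?iota_uniq // => x; rewrite mem_iota /=.
apply/mapP/idP=> [[i _ ->] | ltxn]; first exact: ltn_ord.
by exists ((s^-1)%g (Ordinal ltxn)); rewrite ?mem_enum // permKV.
Qed.

Lemma word_ofP n w : perm_eq w (iota 0 n) -> exists s : 'S_n, word_of s = w.
Proof.
move=> perm_w; have uniq_w : uniq w by rewrite (perm_uniq perm_w) iota_uniq.
have size_w : size w = n by rewrite (perm_size perm_w) size_iota.
have ltw (i : 'I_n) : nth 0 w i < n.
  have : nth 0 w i \in w by rewrite mem_nth // size_w.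
  by rewrite (perm_mem perm_w) mem_iota.
have inj_f : injective (fun i => Ordinal (ltw i)).
  move=> i j [/eqP]; rewrite nth_uniq ?size_w // => /eqP; exact: val_inj.
exists (perm inj_f); apply: (@eq_from_nth _ 0); rewrite size_word_of // => i ltin.
by rewrite (nth_word_of _ (Ordinal ltin)) permE.
Qed.

Definition pos0 : 'I_3 := @Ordinal 3 0 isT.
Definition pos1 : 'I_3 := @Ordinal 3 1 isT.
Definition pos2 : 'I_3 := @Ordinal 3 2 isT.

Lemma forall_pos (P : pred 'I_3) :
  [forall j, P j] = [&& P pos0, P pos1 & P pos2].
Proof.
apply/forallP/and3P=> [P_ | [P0 P1 P2] [[|[|[|//]]] lt3]]; first by split.
- by rewrite (_ : Ordinal lt3 = pos0) //; apply: val_inj.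
- by rewrite (_ : Ordinal lt3 = pos1) //; apply: val_inj.
by rewrite (_ : Ordinal lt3 = pos2) //; apply: val_inj.
Qed.

Definition positions n (x y z : 'I_n) : {ffun 'I_3 -> 'I_n} :=
  [ffun j : 'I_3 => tnth [tuple x; y; z] j].

Lemma positionsE n (x y z : 'I_n) :
  ((positions x y z pos0 = x) * (positions x y z pos1 = y)
    * (positions x y z pos2 = z))%type.
Proof. by rewrite !ffunE !(tnth_nth x). Qed.

Lemma is_psubword_a_bc n (s : 'S_n) (i : {ffun 'I_3 -> 'I_n}) :
  is_psubword (p := pat_a_bc) s i =
  [&& i pos0 < i pos1, i pos2 == (i pos1).+1 :> nat
    & s (i pos0) < s (i pos1) < s (i pos2)].
Proof.
by rewrite /is_psubword !forall_pos /=; lia.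
Qed.

Lemma is_psubword_ac_b n (s : 'S_n) (i : {ffun 'I_3 -> 'I_n}) :
  is_psubword (p := pat_ac_b) s i =
  [&& i pos1 == (i pos0).+1 :> nat, i pos1 < i pos2
    & s (i pos0) < s (i pos2) < s (i pos1)].
Proof.
by rewrite /is_psubword !forall_pos /=; lia.
Qed.

Lemma admissible_word_of n (s : 'S_n) :
  s \in avoiders n pat_a_bc pat_ac_b <-> admissible (word_of s).
Proof.
rewrite inE; split=> [/andP[/existsPn av1 /existsPn av2] u b c v def_w ltbc | adm].
  have szw := size_word_of s; rewrite def_w size_cat /= in szw.
  have ltx : size u < n by lia.
  have lty : (size u).+1 < n by lia.
  pose x := Ordinal ltx; pose y := Ordinal lty.
  have sx : s x = b :> nat.
    by rewrite -nth_word_of def_w nth_cat ltnn subnn.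
  have sy : s y = c :> nat.
    by rewrite -nth_word_of def_w nth_cat /= ltnNge leqnSn subSnn.
  split; apply/allP=> a.
    case/(nthP 0)=> k ltk def_a; have ltkn := ltn_trans ltk ltx.
    have := av1 (positions (Ordinal ltkn) x y).
    have sk : s (Ordinal ltkn) = a :> nat.
      by rewrite -nth_word_of def_w nth_cat ltk.
    by rewrite is_psubword_a_bc !positionsE sx sy sk /= ltk; lia.
  case/(nthP 0)=> k ltk def_a; have ltkn : size u + k.+2 < n.
    by rewrite -szw ltn_add2l !ltnS.
  have := av2 (positions x y (Ordinal ltkn)).
  have sk : s (Ordinal ltkn) = a :> nat.
    by rewrite -nth_word_of def_w nth_cat /= ltnNge leq_addr addKn.
  by rewrite is_psubword_ac_b !positionsE sx sy sk /=; lia.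
have cut (y z : 'I_n) : z = y.+1 :> nat ->
    word_of s = take y (word_of s)
                  ++ [:: s y : nat, s z : nat & drop z.+1 (word_of s)].
  move=> def_z; rewrite -!nth_word_of -drop_nth ?size_word_of //.
  rewrite def_z -drop_nth ?size_word_of //.
  by rewrite cat_take_drop.
apply/andP; split; apply/existsPn=> i.
  rewrite is_psubword_a_bc; apply/negP=> /and3P[lt01 /eqP def2 /andP[lts01 lts12]].
  have [/allP leu _] := adm _ _ _ _ (cut _ _ def2) lts12.
  have mem0 : (s (i pos0) : nat) \in take (i pos1) (word_of s).
    rewrite -nth_word_of -(nth_take _ lt01) mem_nth //.
    by rewrite size_take size_word_of ltn_ord.
  by have := leu _ mem0; rewrite leqNgt lts01.
rewrite is_psubword_ac_b; apply/negP=> /and3P[/eqP def1 lt12 /andP[lts02 lts21]].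
have lts01 := ltn_trans lts02 lts21.
have [_ /allP out] := adm _ _ _ _ (cut _ _ def1) lts01.
have mem2 : (s (i pos2) : nat) \in drop (i pos1).+1 (word_of s).
  rewrite -nth_word_of -[X in nth 0 _ X](subnKC lt12) -nth_drop mem_nth //.
  by rewrite size_drop size_word_of ltn_sub2r // (leq_ltn_trans lt12).
by have := out _ mem2; rewrite leqNgt lts02 leqNgt lts21.
Qed.

(** * The correspondence *)
Definition encodes n (w : n.-tuple motzkin_step) (s : 'S_n) :=
  exists t, val w = steps t /\ word_of s = letters 0 t.

Lemma encodes_path n (w : n.-tuple motzkin_step) : w \in motzkin_paths n ->
  exists2 s, s \in avoiders n pat_a_bc pat_ac_b & encodes w s.
Proof.
rewrite mem_motzkin_paths => /closes_steps[t def_w].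
have := perm_letters 0 t; rewrite -size_steps -def_w size_tuple.
case/word_ofP=> s def_s; exists s; last by exists t.
by apply/admissible_word_of; rewrite def_s; apply: admissible_letters.
Qed.

Lemma encodes_permutation n (s : 'S_n) : s \in avoiders n pat_a_bc pat_ac_b ->
  exists2 w, w \in motzkin_paths n & encodes w s.
Proof.
move/admissible_word_of/(admissible_lettersP (perm_word_of s)) => [t def_s].
have size_t : size (steps t) == n.
  by rewrite size_steps -(size_letters 0) -def_s size_word_of.
exists (Tuple size_t); last by exists t.
by rewrite mem_motzkin_paths /= -[steps t]cats0 closes_steps_cat.
Qed.

Theorem proposition24 (n : nat) :
  (exists f : {w : n.-tuple motzkin_step | w \in motzkin_paths n} ->
              {s : 'S_n | s \in avoiders n pat_a_bc pat_ac_b},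
     bijective f) /\
  #|avoiders n pat_a_bc pat_ac_b| = motzkin_number n.
Proof.
pose P : finType := {w : n.-tuple motzkin_step | w \in motzkin_paths n}.
pose A : finType := {s : 'S_n | s \in avoiders n pat_a_bc pat_ac_b}.
have [f enc_f] : exists f : P -> A, forall w, encodes (val w) (val (f w)).
  apply: (fin_all_exists (P := fun (w : P) (s : A) => encodes (val w) (val s))).
  move=> [w Pw]; have [s As enc] := encodes_path Pw.
  by exists (exist _ s As).
have [g enc_g] : exists g : A -> P, forall s, encodes (val (g s)) (val s).
  apply: (fin_all_exists (P := fun (s : A) (w : P) => encodes (val w) (val s))).
  move=> [s As]; have [w Pw enc] := encodes_permutation As.
  by exists (exist _ w Pw).
have bij_f : bijective f.
  exists g => [w | s]; apply: val_inj.
    have [[t [def_w def_s]] [t' [def_w' def_s']]] := (enc_f w, enc_g (f w)).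
    apply: val_inj; rewrite def_w def_w'; congr steps.
    by apply: (@letters_inj 0); rewrite -def_s -def_s'.
  have [[t [def_w def_s]] [t' [def_w' def_s']]] := (enc_f (g s), enc_g s).
  apply: word_of_inj; rewrite def_s def_s'; congr letters.
  by apply: steps_inj; rewrite -def_w -def_w'.
split; first by exists f.
have := bij_eq_card bij_f; rewrite /P /A !card_sig => eq_card_PA.
exact: esym.
Qed.
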